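(* Let $\mathcal{F}$ be an infinite field. For all integers $n\ge 2$ and $d_1,\ldots,d_n\ge 2$, with $\tilde{d}=d_1d_2\cdots d_n$, \[ \max\bigl\{\dim\mathcal{L} : \mathcal{L}\text{ is a subspace of }\mathcal{F}^{d_1}\otimes\cdots\otimes\mathcal{F}^{d_n}\text{ and has no product basis}\bigr\} = \tilde{d}-2. \]
   Context: A vector $u\in\mathcal{F}^{d_1}\otimes\cdots\otimes\mathcal{F}^{d_n}$ is called a product vector if $u=u^{[1]}\otimes\cdots\otimes u^{[n]}$ for some $u^{[1]}\in\mathcal{F}^{d_1},\ldots,u^{[n]}\in\mathcal{F}^{d_n}$. A product basis of a subspace $\mathcal{L}$ is a basis of $\mathcal{L}$ composed of product vectors. *)

(* Defs.v *)
From HB Require Import structures.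
From mathcomp Require Import all_boot all_algebra.
From mathcomp Require Import classical_sets cardinality.

Set Implicit Arguments.
Unset Strict Implicit.
Unset Printing Implicit Defensive.

Import GRing.Theory.
Local Open Scope ring_scope.

Section Tensor.
Variables (F : fieldType) (n : nat) (d : 'I_n -> nat).

(* F^(d_1) (x) ... (x) F^(d_n) in coordinates: the coefficients of a tensor
   on the basis e_(k_1) (x) ... (x) e_(k_n), indexed by the multi-indices k
   with k_i < d_i. *)
Definition tensor : vectType F :=
  {ffun {dffun forall i : 'I_n, 'I_(d i)} -> F^o}.

(* u^[1] (x) ... (x) u^[n] *)
Definition tprod (u : forall i : 'I_n, 'rV[F]_(d i)) : tensor :=
  [ffun k : {dffun forall i : 'I_n, 'I_(d i)} => \prod_(i < n) u i 0 (k i)].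

Definition product_vector (v : tensor) : Prop :=
  exists u : forall i : 'I_n, 'rV[F]_(d i), v = tprod u.

Definition product_basis (L : {vspace tensor}) (b : seq tensor) : Prop :=
  basis_of L b /\ forall v : tensor, v \in b -> product_vector v.

Definition has_product_basis (L : {vspace tensor}) : Prop :=
  exists b : seq tensor, product_basis L b.

End Tensor.

(* Main.v *)
From HB Require Import structures.
Require Import Defs.
From mathcomp Require Import all_boot all_algebra ring.
From mathcomp Require Import boolp classical_sets cardinality.
Import GRing.Theory.
Local Open Scope ring_scope.

(** Upper bound: if the product vectors of a subspace [L] of codimension at most
    one do not span [L], they are killed by a functional [g] that does not
    vanish on [L = ker f].  Then [f u = 0] implies [g u = 0] for every product
    vector [u], and fixing all factors but one and freeing them one at a time
    shows [g = l * f], so that [g] vanishes on [L] after all.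

    Lower bound: product vectors satisfy [v_11 v_00 = v_10 v_01] (indices in the
    first two slots, all others being 0), so on the codimension-two subspace
    [v_11 = 0, v_10 = v_01] they all have [v_10 = 0], which [e_10 + e_01] does
    not. *)

(** Makes a scalar depending on [w] uniform. In the application [w] is the newly freed slot and [X]
    parametrizes the slots freed earlier. *)
Lemma pointwise_proportional (F : fieldType) (W : lmodType F) (X : Type)
    (M N : W -> X -> F)
    (M_lin : forall a v w x, M (a *: v + w) x = a * M v x + M w x)
    (N_lin : forall a v w x, N (a *: v + w) x = a * N v x + N w x) :
  (forall w, exists l, forall x, N w x = l * M w x) ->
  exists l, forall w x, N w x = l * M w x.
Proof.
move=> prop.
have [[w0 [x0 Mw0]]|M0] := pselect (exists w x, M w x != 0); last first.
  exists 0 => w x; have [l ->] := prop w.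
  have [->|nz] := eqVneq (M w x) 0; first by rewrite !mulr0.
  by case: M0; exists w, x.
(* [N - l * M] vanishes at [w0]; comparing its values at [w] and [w + w0] shows
   that either it vanishes at [w] or [M w] is proportional to [M w0]. *)
have [l Nw0] := prop w0; exists l => w.
have [m Nw] := prop w; have [p] := prop (1 *: w + w0).
move=> Nww0; have {Nww0} dep x : (p - l) * M w0 x = (m - p) * M w x.
  have := Nww0 x; rewrite M_lin N_lin Nw Nw0 !mul1r => e.
  by rewrite !mulrBl -[m * _](addrK (l * M w0 x)) e; ring.
have [pl|pl] := eqVneq p l.
  move=> x; have := dep x; rewrite pl subrr mul0r => /esym/eqP.
  by rewrite mulf_eq0 subr_eq0 Nw => /orP[/eqP -> //|/eqP ->]; rewrite !mulr0.
have mp : m - p != 0.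
  apply: contraNneq pl => mp; have /eqP := dep x0.
  by rewrite mp mul0r mulf_eq0 (negPf Mw0) orbF subr_eq0.
(* The combination is chosen so that [M] vanishes on it; hence so does [N], and [N w] is the same
   multiple of [N w0] as [M w] is of [M w0]. *)
have [q Nq] := prop (- ((p - l) / (m - p)) *: w0 + w).
move=> x; have := Nq x; rewrite M_lin N_lin Nw0.
have -> : M w x = (p - l) / (m - p) * M w0 x.
  by apply: (mulfI mp); rewrite -dep; field.
by move=> e; rewrite !mulNr addNr mulr0 in e; apply/eqP; rewrite -subr_eq0 -e; apply/eqP; ring.
Qed.

Lemma dfwith_same (I : eqType) (T : I -> Type) (u : forall i, T i) (i : I) :
  dfwith u (u i) = u.
Proof. by apply: functional_extensionality_dep => j; case: dfwithP. Qed.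

Lemma multilinear_proportional (F : fieldType) (I : finType)
    (V : I -> lmodType F) (f g : (forall i, V i) -> F)
    (f_lin : forall u i a (v w : V i),
      f (dfwith u (a *: v + w)) = a * f (dfwith u v) + f (dfwith u w))
    (g_lin : forall u i a (v w : V i),
      g (dfwith u (a *: v + w)) = a * g (dfwith u v) + g (dfwith u w)) :
  (forall u, f u = 0 -> g u = 0) -> exists l, forall u, g u = l * f u.
Proof.
move=> fg0.
(* [s] lists the slots that have been freed so far. *)
have partial (s : seq I) (u : forall i, V i) :
    exists l, forall u' : forall i, V i,
      (forall i, i \notin s -> u' i = u i) -> g u' = l * f u'.
  elim: s u => [|j s IHs] u.
    (* If [f u = 0], then [g u = 0] as well and any scalar works. *)
    exists (g u / f u) => u' eq_u.
    have {eq_u}-> : u' = u by apply: functional_extensionality_dep => i; apply: eq_u.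
    by have [/[dup] /fg0 -> ->|fu] := eqVneq (f u) 0; rewrite ?mulr0 ?divfK.
  (* The value of [u'] at [j] is immaterial: [dfwith] overwrites it by [w]. For fixed [w], the
     induction hypothesis at base point [dfwith u w] gives the scalar. *)
  pose X := {u' : forall i, V i | forall i, i \notin j :: s -> u' i = u i}.
  have [|||l lP] := @pointwise_proportional F (V j) X
      (fun w x => f (dfwith (sval x) w)) (fun w x => g (dfwith (sval x) w)).
  - by move=> *; apply: f_lin.
  - by move=> *; apply: g_lin.
  - move=> w; have [l lP] := IHs (dfwith u w); exists l => -[u' eq_u] /=.
    apply: lP => i si; have [ji|ji] := eqVneq j i.
      by move: si; rewrite -{i}ji => _; rewrite !dfwith_in.
    by rewrite !dfwith_out ?eq_u // inE negb_or eq_sym ji.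
  exists l => u' eq_u.
  by have := lP (u' j) (exist _ u' eq_u); rewrite /= dfwith_same.
have [l lP] := partial (enum I) (fun i => 0).
by exists l => u; apply: lP => i; rewrite mem_enum.
Qed.

(** Greedy extension of a free family in [P]: if it gets stuck before reaching [\dim L], its own
    span is the required [U]. *)
Lemma basis_in_or_proper_subspace (F : fieldType) (vT : vectType F)
    (P : vT -> Prop) (L : {vspace vT}) :
  (exists b, basis_of L b /\ forall v, v \in b -> P v) \/
  exists U : {vspace vT}, ~~ (L <= U)%VS /\ forall v, v \in L -> P v -> v \in U.
Proof.
have [?|noU] := pselect (exists U : {vspace vT},
  ~~ (L <= U)%VS /\ forall v, v \in L -> P v -> v \in U); [by right | left].
have free_in k : (k <= \dim L)%N ->
    exists b, [/\ size b = k, free b, (<<b>> <= L)%VS & forall v, v \in b -> P v].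
  elim: k => [|k IHk] kL; first by exists [::]; rewrite nil_free span_nil sub0v.
  have [b [sz_b free_b bL bP]] := IHk (ltnW kL).
  have [[v [vL Pv vb]]|nov] := pselect (exists v, [/\ v \in L, P v & v \notin <<b>>%VS]).
    exists (v :: b); split; rewrite /= ?sz_b ?free_cons ?vb //.
      by rewrite span_cons subv_add bL -memvE vL.
    by move=> w; rewrite inE => /predU1P[->|/bP].
  case: noU; exists <<b>>%VS; split.
    apply: contraL kL => /dimvS; rewrite -leqNgt => /leq_trans; apply.
    by rewrite -sz_b dim_span.
  by move=> v vL Pv; apply/negP => /negP vb; apply: nov; exists v.
have [b [sz_b free_b bL bP]] := free_in _ (leqnn _).
by exists b; split=> //; rewrite basisEfree free_b bL sz_b leqnn.
Qed.

(** Subtracting the projection onto [U] kills [U] but not [v], so some coordinate of the result is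
    nonzero at [v]. *)
Lemma separating_functional (F : fieldType) (vT : vectType F)
    (U : {vspace vT}) (v : vT) :
  v \notin U ->
  exists f : 'Hom(vT, F^o), (U <= lker f)%VS /\ f v != 0.
Proof.
move=> vU; pose p := (\1 - projv U)%VF; pose e := vbasis (@fullv _ vT).
have : p v != 0.
  apply: contra vU; rewrite /p add_lfunE opp_lfunE id_lfunE subr_eq0 => /eqP ->.
  exact: memv_proj.
have e_full : basis_of fullv e := vbasisP _.
rewrite (coord_basis e_full (memvf (p v))) => nz.
have [i ci] : exists i, coord e i (p v) != 0.
  apply/existsP; apply: contraR nz; rewrite negb_exists => /forallP c0.
  by rewrite big1 // => i _; have := c0 i; rewrite negbK => /eqP ->; rewrite scale0r.
exists (linfun (coord e i : vT -> F^o) \o p)%VF; split.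
  apply/subvP => w wU; rewrite memv_ker comp_lfunE.
  by rewrite /p add_lfunE opp_lfunE id_lfunE projv_id // subrr linear0.
by rewrite comp_lfunE lfunE.
Qed.

Lemma tprod_multilinear (F : fieldType) (n : nat) (d : 'I_n -> nat)
    (u : forall i, 'rV[F]_(d i)) (i : 'I_n) (a : F) (v w : 'rV[F]_(d i)) :
  tprod (dfwith u (a *: v + w)) =
  a *: tprod (dfwith u v) + tprod (dfwith u w).
Proof.
have slotE x (k : {dffun forall j, 'I_(d j)}) :
    tprod (dfwith u x) k = x 0 (k i) * \prod_(j < n | j != i) u j 0 (k j).
  rewrite ffunE (bigD1 i) //= dfwith_in; congr (_ * _).
  by apply: eq_bigr => j ji; rewrite dfwith_out // eq_sym.
by apply/ffunP => k; rewrite slotE ffunE [in RHS]ffunE !slotE !mxE mulrDl -mulrA.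
Qed.

Lemma tensor_span_product (F : fieldType) (n : nat) (d : 'I_n -> nat)
    (v : tensor F d) :
  v = \sum_k v k *: tprod (fun i => delta_mx 0 (k i)).
Proof.
apply/ffunP => k; rewrite sum_ffunE (bigD1 k) //= big1 => [|l lk].
  by rewrite !ffunE big1 ?addr0 => [|i _]; rewrite ?mxE ?eqxx //; apply/esym/mulr1.
rewrite !ffunE; suff [i ik] : exists i, k i != l i.
  by rewrite (bigD1 i) //= mxE (negPf ik) andbF mul0r; apply: mulr0.
apply/existsP; apply: contraR lk; rewrite negb_exists => /forallP kl.
by apply/eqP/ffunP => i; have := kl i; rewrite negbK => /eqP.
Qed.

Lemma dim_tensor (F : fieldType) (n : nat) (d : 'I_n -> nat) :
  \dim {:tensor F d} = (\prod_(i < n) d i)%N.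
Proof.
rewrite dimvf /dim /= muln1 card_dep_ffun foldrE big_map -big_enum.
by apply: eq_bigr => i _; rewrite card_ord.
Qed.

Lemma hyperplane_kernel (F : fieldType) (vT : vectType F) (L : {vspace vT}) :
  (\dim {:vT} <= (\dim L).+1)%N -> exists f : 'Hom(vT, F^o), lker f = L.
Proof.
move=> dimL; have [->|] := eqVneq L fullv.
  by exists 0; apply/vspaceP => v; rewrite memv_ker zero_lfunE eqxx memvf.
rewrite eqEsubv subvf /= => /subvPn[v _ vL].
have [f [Lf fv]] := separating_functional _ _ _ _ vL; exists f.
(* The kernel contains [L] and misses [v], so its dimension is at most that of [L]. *)
apply/esym/eqP; rewrite eqEdim Lf /= -ltnS; apply: leq_trans dimL.
rewrite ltnNge; apply: contra fv => full.
by rewrite -memv_ker (_ : lker f = fullv) ?memvf //; apply/eqP; rewrite eqEdim subvf.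
Qed.

Lemma hyperplane_has_product_basis (F : fieldType) (n : nat) (d : 'I_n -> nat)
    (L : {vspace tensor F d}) :
  (\prod_(i < n) d i <= (\dim L).+1)%N -> has_product_basis L.
Proof.
move=> dimL.
have [[b bP]|[U [LU UP]]] := basis_in_or_proper_subspace _ _ (product_vector (d := d)) L.
  by exists b.
have [v vL vU] := subvPn LU.
have [g [Ug gv]] := separating_functional _ _ _ _ vU.
have [f fL] : exists f : 'Hom(tensor F d, F^o), lker f = L.
  by apply: hyperplane_kernel; rewrite dim_tensor.
have [|||l lP] := @multilinear_proportional F 'I_n (fun i => 'rV[F]_(d i))
  (fun u => f (tprod u)) (fun u => g (tprod u)).
- by move=> u i a x y; rewrite tprod_multilinear linearP.
- by move=> u i a x y; rewrite tprod_multilinear linearP.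
- move=> u fu; suff : tprod u \in lker g by rewrite memv_ker => /eqP.
  apply/(subvP Ug)/UP; last by exists u.
  by rewrite -fL memv_ker; apply/eqP.
(* Products of unit vectors span, so proportionality extends to all tensors. *)
have gf x : g x = l * f x.
  rewrite [x]tensor_span_product !linear_sum mulr_sumr.
  by apply: eq_bigr => k _; rewrite !linearZ /= lP mulrCA.
by move: vL gv; rewrite -fL memv_ker gf => /eqP ->; rewrite mulr0 eqxx.
Qed.

(** In each slot both sides multiply the same two entries of [u i], up to order. *)
Lemma tprod_exchange (F : fieldType) (n : nat) (d : 'I_n -> nat)
    (z o : forall i : 'I_n, 'I_(d i)) (p q : pred 'I_n) (v : tensor F d) :
  let at_ (r : pred 'I_n) : {dffun forall i : 'I_n, 'I_(d i)} :=
    [ffun i => if r i then o i else z i] in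
  product_vector v ->
  v (at_ p) * v (at_ q) = v (at_ (predU p q)) * v (at_ (predI p q)).
Proof.
move=> at_ [u ->]; rewrite !ffunE -!big_split /=; apply: eq_bigr => i _.
by rewrite !ffunE /=; case: (p i); case: (q i) => //=; rewrite mulrC.
Qed.

(** Both equations form one map into a plane, so that rank-nullity bounds the codimension of its
    kernel by 2. *)
Definition entry_constraints (F : fieldType) (n : nat) (d : 'I_n -> nat)
    (k l m : {dffun forall i : 'I_n, 'I_(d i)}) (v : tensor F d) : F^o * F^o :=
  (v k, v l - v m).

Lemma entry_constraints_linear (F : fieldType) (n : nat) (d : 'I_n -> nat)
    (k l m : {dffun forall i : 'I_n, 'I_(d i)}) :
  linear (entry_constraints F n d k l m).
Proof.
move=> a v w; congr pair; rewrite !ffunE //.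
have sub_lin (x x' y y' : F) :
  a * x + x' - (a * y + y') = a * (x - y) + (x' - y') by ring.
exact: sub_lin.
Qed.

HB.instance Definition _ (F : fieldType) (n : nat) (d : 'I_n -> nat)
    (k l m : {dffun forall i : 'I_n, 'I_(d i)}) :=
  GRing.isLinear.Build F (tensor F d) (F^o * F^o)%type *:%R
    (entry_constraints F n d k l m) (entry_constraints_linear F n d k l m).

Lemma no_product_basis_codim2 (F : fieldType) (n : nat) (n_ge2 : (2 <= n)%N)
    (d : 'I_n -> nat) (d_ge2 : forall i : 'I_n, (2 <= d i)%N) :
  exists L : {vspace tensor F d},
    ~ has_product_basis L /\ (\prod_(i < n) d i - 2 <= \dim L)%N.
Proof.
pose z i : 'I_(d i) := Ordinal (ltnW (d_ge2 i)).
pose o i : 'I_(d i) := Ordinal (d_ge2 i).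
pose i0 := Ordinal (ltnW n_ge2); pose i1 := Ordinal n_ge2.
pose at_ (r : pred 'I_n) : {dffun forall i : 'I_n, 'I_(d i)} :=
  [ffun i => if r i then o i else z i].
pose k11 := at_ (predU (pred1 i0) (pred1 i1)).
pose k10 := at_ (pred1 i0); pose k01 := at_ (pred1 i1).
pose h := linfun (entry_constraints F n d k11 k10 k01).
pose L := lker (h); exists L; split; last first.
  have := limg_ker_dim (h) fullv; rewrite capfv -/L dim_tensor => <-.
  rewrite leq_subLR [(2 + _)%N]addnC leq_add2l.
  by apply: leq_trans (dimvS (subvf _)) _; rewrite dimvf.
have LP v : v \in L = (v k11 == 0) && (v k10 == v k01).
  by rewrite memv_ker lfunE /= -pair_eqE /= subr_eq0.
case=> b [/andP[/eqP spanb _] b_prod].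
have b10 v : v \in b -> v k10 = 0.
  move=> vb; have := tprod_exchange _ _ _ z o (pred1 i0) (pred1 i1) v (b_prod v vb).
  rewrite /= -/(at_ _) -/k11 -/k10 -/k01.
  have : v \in L by rewrite -spanb memv_span.
  (* On [L] the exchange identity reads [v k10 * v k10 = 0]. *)
  rewrite LP => /andP[/eqP -> /eqP <-]; rewrite mul0r => /eqP.
  by rewrite mulf_eq0 orbb => /eqP.
pose w : tensor F d := [ffun k => ((k == k10) || (k == k01))%:R].
have : w \in L.
  have at_neq r s i : r i != s i -> (at_ r == at_ s) = false.
    move=> rs; apply: contraNF rs => /eqP/ffunP/(_ i); rewrite !ffunE.
    by case: (r i); case: (s i) => // /(congr1 val).
  (* [k11] differs from [k10] in slot [i1] and from [k01] in slot [i0], so [w k11 = 0]. *)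
  by rewrite LP /w !ffunE !eqxx orbT (at_neq _ _ i1) // (at_neq _ _ i0) ?eqxx.
rewrite -spanb => /(@coord_span _ _ _ (in_tuple b)) ww.
have : w k10 = 0.
  rewrite ww sum_ffunE big1 // => i _; rewrite !ffunE b10 ?scaler0 //.
  exact: mem_nth.
by rewrite ffunE eqxx => /eqP; rewrite oner_eq0.
Qed.

Theorem mainTheorem3 (F : fieldType) (Finf : infinite_set [set: F]%classic)
    (n : nat) (n_ge2 : (2 <= n)%N)
    (d : 'I_n -> nat) (d_ge2 : forall i : 'I_n, (2 <= d i)%N) :
  (exists L : {vspace tensor F d},
     ~ has_product_basis L /\ \dim L = ((\prod_(i < n) d i) - 2)%N) /\
  (forall L : {vspace tensor F d},
     ~ has_product_basis L -> (\dim L <= (\prod_(i < n) d i) - 2)%N).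
Proof.
have upper (L : {vspace tensor F d}) :
    ~ has_product_basis L -> (\dim L <= (\prod_(i < n) d i) - 2)%N.
  move=> noL; rewrite leqNgt; apply: contra_notN noL => dimL.
  apply: hyperplane_has_product_basis.
  by apply: leq_trans (_ : _ <= 2 + (\prod_(i < n) d i - 2))%N _; rewrite -?leq_subLR.
split=> //; have [L [noL dimL]] := no_product_basis_codim2 F n n_ge2 d d_ge2.
(* The construction bounds [\dim L] only from below; [upper] gives equality. *)
by exists L; split=> //; apply/eqP; rewrite eqn_leq upper.
Qed.
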